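(* Let $G$ be a group, $I$ and $\Lambda$ nonempty sets, and $P=(p_{\lambda i})$ a $\Lambda\times I$ matrix with entries in $G^0=G\cup\{0\}$ such that no row or column of $P$ consists entirely of zeros. If $P$ has any $0$ entries, then $\sim_s$ is the universal relation on the Rees matrix semigroup $\mathcal{M}^0(G;I,\Lambda;P)$.
   Context: $\mathcal{M}^0(G;I,\Lambda;P)$ is the semigroup $(I\times G\times\Lambda)\cup\{0\}$ with multiplication $(i,s,\lambda)(j,t,\mu)=(i,sp_{\lambda j}t,\mu)$ if $p_{\lambda j}\neq 0$, $(i,s,\lambda)(j,t,\mu)=0$ if $p_{\lambda j}=0$, and $(i,s,\lambda)0=0=0(i,s,\lambda)=0\cdot 0$. For a semigroup $S$, $S^1$ denotes the monoid obtained by adjoining an identity element $1$ to $S$; if $S$ is already a monoid, $S^1=S$. For $s,t\in S$, $s\sim_s^1 t$ means there exist a positive integer $n$, elements $p_1,\dots,p_n\in S^1$, and a permutation $f$ of $\{1,\dots,n\}$ with $s=p_1\cdots p_n$ and $t=p_{f(1)}\cdots p_{f(n)}$; $\sim_s$ is the transitive closure of $\sim_s^1$. The universal relation on $S$ is $S\times S$. *)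

(* Defs.v *)
From HB Require Import structures.
From mathcomp Require Import all_boot fingroup perm.
From mathcomp Require Import boolp.
From Stdlib Require Import Relation_Operators.

Set Implicit Arguments.
Unset Strict Implicit.
Unset Printing Implicit Defensive.

Local Open Scope group_scope.

Section AdjoinOne.
Variable S : semigroupType.

Definition is_identity (e : S) : Prop := forall x : S, e * x = x /\ x * e = x.

Definition has_identity : Prop := exists e : S, is_identity e.

(* The monoid S^1: [Some s] is the element s of S and [None] is the adjoined
   identity, which is an element of S^1 only when S is not already a monoid. *)
Record adjoin1 := Adjoin1 {
  adjoin1_val :> option S;
  adjoin1P : isSome adjoin1_val || `[< ~ has_identity >]
}.

HB.instance Definition _ := [isSub for adjoin1_val].
HB.instance Definition _ := [Choice of adjoin1 by <:].

Definition adjoin1_in (s : S) : adjoin1 := @Adjoin1 (Some s) isT.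

Definition adjoin1_mul_val (x y : option S) : option S :=
  match x, y with
  | Some s, Some t => Some (s * t)
  | Some _, None => x
  | None, _ => y
  end.

Lemma adjoin1_mulP (x y : adjoin1) :
  isSome (adjoin1_mul_val x y) || `[< ~ has_identity >].
Proof. by case: x y => [[s|] hx] [[t|] hy]. Qed.

Definition adjoin1_mul (x y : adjoin1) : adjoin1 := Adjoin1 (adjoin1_mulP x y).

Definition adjoin1_one : adjoin1 :=
  match pselect has_identity with
  | left h => adjoin1_in (sval (cid h))
  | right h => @Adjoin1 None (asboolT h)
  end.

Lemma adjoin1_mulA : associative adjoin1_mul.
Proof.
by move=> [[x|] ?] [[y|] ?] [[z|] ?]; apply/val_inj => //=; rewrite mulgA.
Qed.

Lemma adjoin1_mul1 : left_id adjoin1_one adjoin1_mul.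
Proof.
move=> x; apply/val_inj; rewrite /adjoin1_one; case: pselect => h //=.
case: x => [[x|] hx] /=; last by move: hx => /= /asboolP.
by case: cid => e /= /(_ x) [->].
Qed.

Lemma adjoin1_mulr1 : right_id adjoin1_one adjoin1_mul.
Proof.
move=> x; apply/val_inj; rewrite /adjoin1_one; case: pselect => h /=.
  case: x => [[x|] hx] /=; last by move: hx => /= /asboolP.
  by case: cid => e /= /(_ x) [_ ->].
by case: x => [[x|] hx].
Qed.

HB.instance Definition _ :=
  isMonoid.Build adjoin1 adjoin1_mulA adjoin1_mul1 adjoin1_mulr1.

End AdjoinOne.

Section PermutationConjugacy.
Variable S : semigroupType.

Definition sim_s1 (s t : S) : Prop :=
  exists (n : nat) (p : 'I_n -> adjoin1 S) (f : {perm 'I_n}),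
    [/\ (0 < n)%N,
        adjoin1_in s = \prod_(i < n) p i &
        adjoin1_in t = \prod_(i < n) p (f i)].

Definition sim_s : S -> S -> Prop := clos_trans S sim_s1.

End PermutationConjugacy.

(* The carrier of M^0(G; I, Lambda; P). In [option G], which is G^0, and in the
   carrier, [None] is 0. The phantom argument P lets the type determine the
   multiplication. *)
Definition rees (G : groupType) (I Lambda : Type)
    (P : Lambda -> I -> option G) : Type :=
  option (I * G * Lambda).

Section Rees.
Variables (G : groupType) (I Lambda : Type) (P : Lambda -> I -> option G).

HB.instance Definition _ := gen_eqMixin (rees P).
HB.instance Definition _ := gen_choiceMixin (rees P).

Definition rees_mul (x y : rees P) : rees P :=
  match x, y with
  | Some (i, s, l), Some (j, t, m) =>
      if P l j is Some q then Some (i, s * q * t, m) else None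
  | _, _ => None
  end.

Lemma rees_mulA : associative rees_mul.
Proof.
move=> [[[i s] l]|] [[[j t] m]|] [[[k u] n]|] //=; last by case: (P l j).
by case E: (P l j) => [a|]; case F: (P m k) => [b|] //=;
  rewrite ?E ?F //= !mulgA.
Qed.

HB.instance Definition _ := isSemigroup.Build (rees P) rees_mulA.

End Rees.

(* Main.v *)
Require Import Defs.
From mathcomp Require Import all_boot fingroup perm.

(** The zero of the Rees matrix semigroup is related to every element, in both
    directions. A product [x * y * z] is related in one step to [x * z * y], so
    it is enough to write an arbitrary [s] as [x * y * z] with [x * z * y] zero.
    Let the zero entry of P be in row l0 and column i0. For [s = (i, g, m)] the
    factors are [(i, 1, l0)], [(i1, h, l1)] and [(i0, g, m)]: the middle one
    separates the index l0 from the index i0, and row l0 and column i0 have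
    nonzero entries, at i1 and l1 respectively, so the product is nonzero.
    Exchanging the last two factors puts l0 next to i0, and the zero entry
    annihilates the product. For [s = 0] three zero factors do. *)

Set Implicit Arguments.
Unset Strict Implicit.
Unset Printing Implicit Defensive.

Local Open Scope group_scope.

Lemma adjoin1_inM (S : semigroupType) (x y : S) :
  adjoin1_in (x * y) = adjoin1_in x * adjoin1_in y.
Proof. exact/val_inj. Qed.

(** The statement is invariant under exchanging y and z, so it leads to zero and
    back from it, without an appeal to the symmetry of [sim_s1]. *)
Lemma sim_s1_swap (S : semigroupType) (x y z : S) :
  sim_s1 (x * y * z) (x * z * y).
Proof.
pose i1 : 'I_3 := lift ord0 ord0; pose i2 : 'I_3 := lift ord0 (lift ord0 ord0).
pose p (i : 'I_3) := adjoin1_in (nth x [:: x; y; z] i).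
exists 3, p, (tperm i1 i2); split => //.
  by rewrite !big_ord_recl big_ord0 mulg1 !adjoin1_inM mulgA.
by rewrite !big_ord_recl big_ord0 mulg1 tpermD // tpermL tpermR !adjoin1_inM mulgA.
Qed.

Section ReesZero.
Variables (G : groupType) (I Lambda : Type) (P : Lambda -> I -> option G).

Let rzero : rees P := None.

Lemma rees_factor_swap0 (l0 : Lambda) (i0 : I) (s : rees P) :
    P l0 i0 = None ->
    (exists i, P l0 i <> None) -> (exists l, P l i0 <> None) ->
  exists x y z : rees P, s = x * y * z /\ x * z * y = rzero.
Proof.
move=> P00 [i1 P01] [l1 P10].
case: s => [[[i g] m]|]; last by exists rzero, rzero, rzero.
case E01: (P l0 i1) P01 => [a|] // _; case E10: (P l1 i0) P10 => [b|] // _.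
(* The group entry of the middle factor cancels the two entries of P that the
   product picks up. *)
exists (Some (i, 1, l0)), (Some (i1, a^-1 * b^-1, l1)), (Some (i0, g, m)).
rewrite /mul /= P00 E01 /= E10; split => //.
by rewrite mul1g mulKVg mulVg mul1g.
Qed.

End ReesZero.

Theorem corollary21 (G : groupType) (I Lambda : Type)
    (hI : inhabited I) (hLambda : inhabited Lambda)
    (P : Lambda -> I -> option G)
    (hrow : forall l : Lambda, exists i : I, P l i <> None)
    (hcol : forall i : I, exists l : Lambda, P l i <> None)
    (hzero : exists (l : Lambda) (i : I), P l i = None) :
  forall x y : rees P, sim_s x y.
Proof.
case: hzero => l0 [i0 P00] s t.
have factor u := rees_factor_swap0 u P00 (hrow l0) (hcol i0).
have [x [y [z [-> xzy0]]]] := factor s.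
have [x' [y' [z' [-> xzy0']]]] := factor t.
apply: Relation_Operators.t_trans; apply: Relation_Operators.t_step.
  exact: sim_s1_swap.
rewrite xzy0 -xzy0'; exact: sim_s1_swap.
Qed.
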